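(* Let $n\ge1$ and let $N=N(n)=(4\cdot 6^n+1)/5$, which is the dimension of the transportation cost space $\mathrm{TC}(\mathcal{L}_n)$ of the $n$-th Laakso graph. Then the Banach-Mazur distance from $\mathrm{TC}(\mathcal{L}_n)$ to $\ell_1^N$ satisfies $$d_{BM}(\mathrm{TC}(\mathcal{L}_n),\ell_1^N)\ge \frac{3n-5}{8}.$$
   Context: Laakso graphs: $\mathcal{L}_0$ is the graph with two vertices joined by one edge. $\mathcal{L}_1$ is the graph with vertices $b,u,p,q,v,t$ and six edges $bu, up, pv, uq, qv, vt$; its two vertices of degree 1 are $b$ and $t$. For $n\ge1$, $\mathcal{L}_n$ is obtained from $\mathcal{L}_{n-1}$ by replacing each edge $xy$ by a copy of $\mathcal{L}_1$, identifying $x$ and $y$ with the degree-1 vertices $b$ and $t$ of that copy. The vertex set of $\mathcal{L}_n$ is given the (unweighted) shortest path metric. Transportation cost space: for a finite metric space $(X,d)$, $\mathrm{TC}(X)$ is the space of all functions $f:X\to\mathbb{R}$ with $\sum_{v\in X}f(v)=0$, with norm $\|f\|_{\mathrm{TC}}=\inf \sum_i a_i d(x_i,y_i)$, the infimum over all finite representations $f=\sum_i a_i(\mathbf{1}_{x_i}-\mathbf{1}_{y_i})$ with $a_i\ge0$, $x_i,y_i\in X$, where $\mathbf 1_u$ is the indicator function of $u$. Banach-Mazur distance of two normed spaces of equal finite dimension: $d_{BM}(X,Y)=\inf\{\|T\|\,\|T^{-1}\| : T:X\to Y \text{ a linear isomorphism}\}$. *)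

(* Defs.v *)
From HB Require Import structures.
From mathcomp Require Import all_boot all_order all_algebra.
From mathcomp Require Import all_classical all_reals all_analysis.

Set Implicit Arguments.
Unset Strict Implicit.
Unset Printing Implicit Defensive.

Import Order.TTheory GRing.Theory Num.Theory.
Import numFieldNormedType.Exports.

Local Open Scope classical_set_scope.
Local Open Scope ring_scope.

(* The pair [ends e] only serves to name the two ends of [e]: adjacency is
   symmetric. *)
Record graph := Graph {
  vertex : finType;
  edge : finType;
  ends : edge -> vertex * vertex }.

Definition adj (G : graph) : rel (vertex G) := fun x y =>
  [exists e : edge G, (ends e == (x, y)) || (ends e == (y, x))].

Definition connected_graph (G : graph) :=
  forall x y : vertex G, connect (@adj G) x y.

(* Least length of a path from x to y.  In a connected graph it is less than
   #|vertex G|; the search returns #|vertex G| if there is no path. *)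
Definition gdist (G : graph) (x y : vertex G) : nat :=
  find (fun k => [exists p : k.-tuple (vertex G),
                    path (@adj G) x p && (last x p == y)])
       (iota 0 #|vertex G|).

(* The edges of a copy of the first Laakso graph with ends b and t, its inner
   vertices being u = 0, p = 1, q = 2, v = 3. *)
Definition laakso_edges (V : Type) (b t : V) (inner : 'I_4 -> V) : 6.-tuple (V * V) :=
  let u := inner (inord 0) in let p := inner (inord 1) in
  let q := inner (inord 2) in let v := inner (inord 3) in
  [tuple (b, u); (u, p); (p, v); (u, q); (q, v); (v, t)].

(* Replace every edge by a copy of the first Laakso graph; since the latter has
   an automorphism exchanging b and t, the orientation [ends e] is irrelevant. *)
Definition laakso_step (G : graph) : graph :=
  @Graph (vertex G + edge G * 'I_4)%type (edge G * 'I_6)%type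
    (fun ek =>
       let: (e, k) := ek in
       let b := inl (ends e).1 in
       let t := inl (ends e).2 in
       tnth (laakso_edges b t (fun i => inr (e, i))) k).

Definition single_edge : graph :=
  @Graph bool unit (fun=> (false, true)).

Definition laakso (n : nat) : graph := iter n laakso_step single_edge.

Record finMetric (R : realType) := FinMetric {
  point :> finType;
  fdist : point -> point -> R;
  fdist_eq0 : forall x y, (fdist x y == 0) = (x == y);
  fdistC : forall x y, fdist x y = fdist y x;
  fdist_triangle : forall x y z, fdist x z <= fdist x y + fdist y z }.

Lemma fdist_ge0 (R : realType) (X : finMetric R) (x y : X) : 0 <= fdist x y.
Proof.
have xx : fdist x x = 0 by apply/eqP; rewrite fdist_eq0.
have := fdist_triangle x y x; rewrite xx (fdistC y x) -mulr2n.
by rewrite pmulrn_lge0.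
Qed.

Section GraphMetric.
Variable G : graph.
Implicit Types x y z : vertex G.

Lemma adjC x y : adj x y = adj y x.
Proof. by apply: eq_existsb => e; rewrite orbC. Qed.

Lemma gdist_le x p : path (@adj G) x p -> (gdist x (last x p) <= size p)%N.
Proof.
move=> xp; have [lt_p|le_p] := ltnP (size p) #|vertex G|; last first.
  by rewrite (leq_trans _ le_p)// -[X in (_ <= X)%N](size_iota 0) find_size.
rewrite leqNgt; apply/negP => /(before_find 0)/=.
rewrite nth_iota// add0n => /existsP[]; exists (in_tuple p).
by rewrite /= xp eqxx.
Qed.

Hypothesis cG : connected_graph G.

Lemma gdist_path x y :
  exists p, [/\ path (@adj G) x p, last x p = y & size p = gdist x y].
Proof.
have /connectP[p0 xp0 ->] := cG x y.
case/shortenP: xp0 => p xp up _.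
have lt_p : (size p < #|vertex G|)%N.
  by have := max_card (mem (x :: p)); rewrite (card_uniqP up).
have : has (fun k => [exists q : k.-tuple (vertex G),
    path (@adj G) x q && (last x q == last x p)]) (iota 0 #|vertex G|).
  apply/hasP; exists (size p); first by rewrite mem_iota.
  by apply/existsP; exists (in_tuple p); rewrite /= xp eqxx.
move=> h; have := nth_find 0%N h; rewrite -/(gdist x (last x p)).
rewrite nth_iota; last by rewrite has_find size_iota in h.
rewrite add0n => /existsP[q /andP[xq /eqP lq]].
by exists q; rewrite size_tuple.
Qed.


Lemma gdist_eq0 x y : (gdist x y == 0)%N = (x == y).
Proof.
apply/eqP/eqP => [xy0|->].
  have [p [_ py]] := gdist_path x y.
  by rewrite xy0 -py => /size0nil ->.
by apply/eqP; rewrite -leqn0 (@gdist_le y [::]).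
Qed.

Lemma gdist_sym x y : gdist x y = gdist y x.
Proof.
suff le x' y' : (gdist x' y' <= gdist y' x')%N by apply/eqP; rewrite eqn_leq !le.
have [p [yp px <-]] := gdist_path y' x'.
have := @gdist_le x' (rev (belast y' p)).
rewrite size_rev size_belast -{1}px rev_path.
rewrite (eq_path (e' := @adj G)) => [|a b]; last exact: adjC.
move=> /(_ yp); suff -> : last x' (rev (belast y' p)) = y' by [].
by case: p {yp} px => //= a p _; rewrite rev_cons last_rcons.
Qed.

Lemma gdist_triangle x y z : (gdist x z <= gdist x y + gdist y z)%N.
Proof.
have [p [xp py <-]] := gdist_path x y; have [q [yq qz <-]] := gdist_path y z.
rewrite -size_cat; have := @gdist_le x (p ++ q).
by rewrite last_cat py qz cat_path xp py yq; apply.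
Qed.

Definition graph_metric (R : realType) : finMetric R.
Proof.
apply: (@FinMetric R (vertex G) (fun x y => (gdist x y)%:R)).
- by move=> x y; rewrite pnatr_eq0 gdist_eq0.
- by move=> x y; rewrite gdist_sym.
- by move=> x y z; rewrite -natrD ler_nat gdist_triangle.
Defined.

End GraphMetric.

Lemma laakso_connected n : connected_graph (laakso n).
Proof.
elim: n => [|n]; rewrite /laakso /=.
  have ft : @adj single_edge false true.
    by apply/existsP; exists tt; rewrite eqxx.
  by move=> [] []; rewrite ?connect0//; apply: connect1; rewrite // adjC.
rewrite -/(laakso n); move: (laakso n) => G cG.
set G' := laakso_step G.
have sym : connect_sym (@adj G') by apply: sym_connect_sym => x y; exact: adjC.
pose I e k : vertex G' := inr (e, k).
pose b e : vertex G' := inl (ends e).1.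
pose t e : vertex G' := inl (ends e).2.
have E e (k : 'I_6) : let c := tnth (laakso_edges (b e) (t e) (I e)) k in
    connect (@adj G') c.1 c.2.
  move=> c; apply: connect1; apply/existsP; exists (e, k).
  by rewrite /= -/c -surjective_pairing eqxx.
have bu e : connect (@adj G') (b e) (I e (inord 0)) := E e (@Ordinal 6 0 isT).
have up e : connect (@adj G') (I e (inord 0)) (I e (inord 1)) :=
  E e (@Ordinal 6 1 isT).
have pv e : connect (@adj G') (I e (inord 1)) (I e (inord 3)) :=
  E e (@Ordinal 6 2 isT).
have uq e : connect (@adj G') (I e (inord 0)) (I e (inord 2)) :=
  E e (@Ordinal 6 3 isT).
have vt e : connect (@adj G') (I e (inord 3)) (t e) := E e (@Ordinal 6 5 isT).
have bI e k : connect (@adj G') (b e) (I e k).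
  have up' := connect_trans (bu e) (up e).
  have pv' := connect_trans up' (pv e).
  have uq' := connect_trans (bu e) (uq e).
  rewrite -(inord_val k); case: k => [[|[|[|[|]]]]]//=.
have bt e : connect (@adj G') (b e) (t e) := connect_trans (bI e _) (vt e).
have lift (x y : vertex G) : connect (@adj G') (inl x) (inl y).
  have /connectP[p xp ->] := cG x y; elim: p x xp => [|a p IH] x /=.
    by rewrite connect0.
  case/andP => /existsP[e exa] /IH; apply: connect_trans.
  case/orP: exa => /eqP ee; first by have := bt e; rewrite /b /t ee.
  by rewrite sym; have := bt e; rewrite /b /t ee.
have base z : exists x : vertex G, connect (@adj G') (inl x) z.
  case: z => [x|[e k]]; first by exists x; rewrite connect0.
  by exists (ends e).1; exact: bI.
move=> z w; have [x xz] := base z; have [y yw] := base w.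
by rewrite (connect_trans _ yw)// (connect_trans _ (lift x y))// sym.
Qed.

Definition laakso_metric (R : realType) (n : nat) : finMetric R :=
  graph_metric (@laakso_connected n) R.

Section TransportationCost.
Context {R : realType} {X : finMetric R}.
Implicit Types f g : {ffun X -> R^o}.

Definition total (f : {ffun X -> R^o}) : R^o := \sum_v f v.

Lemma total_is_linear : linear total.
Proof.
move=> a f g; rewrite /total scaler_sumr -big_split.
by apply: eq_bigr => v _; rewrite !ffunE.
Qed.

HB.instance Definition _ :=
  GRing.isLinear.Build R {ffun X -> R^o} R^o _ total total_is_linear.

Definition tc_space : {vspace {ffun X -> R^o}} := lker (linfun total).

Lemma tc_spaceP f : reflect (\sum_v f v = 0) (f \in tc_space).
Proof. by rewrite memv_ker lfunE; exact: eqP. Qed.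

Definition indic (u : X) : {ffun X -> R^o} := [ffun v => (v == u)%:R].

(* The list of the triples (a_i, x_i, y_i) of a finite representation. *)
Definition plan := seq (R * X * X).

Definition represents (s : plan) (f : {ffun X -> R^o}) :=
  (forall c, c \in s -> 0 <= c.1.1) /\
  f = \sum_(c <- s) c.1.1 *: (indic c.1.2 - indic c.2).

Definition cost (s : plan) : R := \sum_(c <- s) c.1.1 * fdist c.1.2 c.2.

Definition tc_norm (f : {ffun X -> R^o}) : R :=
  inf [set cost s | s in [set s | represents s f]].

Lemma cost_ge0 s f : represents s f -> 0 <= cost s.
Proof.
move=> [s0 _]; rewrite /cost big_seq sumr_ge0// => c /s0 c0.
by rewrite mulr_ge0// fdist_ge0.
Qed.

Lemma tc_norm_lb f : has_lbound [set cost s | s in [set s | represents s f]].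
Proof. by exists 0 => _ [s /cost_ge0 ? <-]. Qed.

Lemma tc_norm_le s f : represents s f -> tc_norm f <= cost s.
Proof. by move=> sf; apply: ge_inf; [exact: tc_norm_lb|exists s]. Qed.

Lemma represents_ex f : f \in tc_space -> exists s, represents s f.
Proof.
move=> /tc_spaceP f0; have [x0 _|X0] := pickP X; last first.
  by exists [::]; split => //; apply/ffunP => v; have := X0 v.
exists [seq (if 0 <= f v then (f v, v, x0) else (- f v, x0, v)) | v : X].
split=> [_ /mapP[v _ ->]|].
  by case: ifPn => //=; rewrite -ltNge oppr_ge0 => /ltW.
rewrite big_map big_enum/=.
transitivity (\sum_v f v *: (indic v - indic x0)); last first.
  by apply: eq_bigr => v _; case: ifP => // _; rewrite scaleNr -scalerN opprB.
apply/ffunP => w; rewrite sum_ffunE.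
under eq_bigr do rewrite !ffunE scalerBr.
rewrite sumrB -scaler_suml f0 scale0r subr0 (bigD1 w)//= eqxx big1 ?addr0 => [|v].
  by rewrite /GRing.scale/= mulr1.
by rewrite eq_sym => /negbTE ->; rewrite scaler0.
Qed.

Lemma tc_norm_lt f e : f \in tc_space -> 0 < e ->
  exists2 s, represents s f & cost s < tc_norm f + e.
Proof.
move=> /represents_ex[s0 s0f] e0.
have hi : has_inf [set cost s | s in [set s | represents s f]].
  by split; [exists (cost s0), s0|exact: tc_norm_lb].
by have [_ [s sf <-] lt_s] := inf_adherent e0 hi; exists s.
Qed.

Lemma tc_normD f g : f \in tc_space -> g \in tc_space ->
  tc_norm (f + g) <= tc_norm f + tc_norm g.
Proof.
move=> fT gT; apply/ler_addgt0Pr => e e0; have e20 : 0 < e / 2 by rewrite divr_gt0.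
have [s [s0 sE] lt_s] := tc_norm_lt fT e20.
have [r [r0 rE] lt_r] := tc_norm_lt gT e20.
rewrite (splitr e) addrACA; apply: (le_trans _ (ltW (ltrD lt_s lt_r))).
rewrite /cost -big_cat; apply: tc_norm_le; split; last by rewrite big_cat -sE -rE.
by move=> c; rewrite mem_cat => /orP[/s0|/r0].
Qed.

Lemma tc_normZ_le a f : f \in tc_space -> tc_norm (a *: f) <= `|a| * tc_norm f.
Proof.
move=> fT; apply/ler_addgt0Pr => e e0.
have a1 : 0 < `|a| + 1 by rewrite ltr_wpDl.
have [s [s0 sE] lt_s] := tc_norm_lt fT (divr_gt0 e0 a1).
pose sc (c : R * X * X) :=
  if 0 <= a then (a * c.1.1, c.1.2, c.2) else (- a * c.1.1, c.2, c.1.2).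
apply: (@le_trans _ _ (cost (map sc s))).
  apply: tc_norm_le; split => [_ /mapP[c /s0 c0 ->]|].
    rewrite /sc; case: ifPn => /= [a0|]; first by rewrite mulr_ge0.
    by rewrite -ltNge => /ltW a0; rewrite mulr_ge0// oppr_ge0.
  rewrite {1}sE big_map scaler_sumr; apply: eq_bigr => c _; rewrite /sc.
  by case: ifP => _ /=; rewrite scalerA// mulNr scaleNr -scalerN opprB.
have -> : cost (map sc s) = `|a| * cost s.
  rewrite /cost big_map mulr_sumr; apply: eq_bigr => c _; rewrite /sc mulrA.
  case: ifPn => /= [a0|]; first by rewrite ger0_norm.
  by rewrite -ltNge => a0; rewrite ltr0_norm// fdistC.
rewrite (le_trans (ler_wpM2l (normr_ge0 a) (ltW lt_s)))// mulrDr lerD2l.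
rewrite mulrCA ler_piMr ?ltW// ltr_pdivrMr// mul1r.
by rewrite ltrDl.
Qed.

Lemma tc_normZ a f : f \in tc_space -> tc_norm (a *: f) = `|a| * tc_norm f.
Proof.
move=> fT; apply/eqP; rewrite eq_le tc_normZ_le//=.
have [->|a0] := eqVneq a 0.
  rewrite normr0 mul0r scale0r; apply: lb_le_inf; last first.
    by move=> _ [s /cost_ge0 ? <-].
  by exists (cost [::]), [::] => //; split => //; rewrite big_nil.
rewrite mulrC -ler_pdivlMr ?normr_gt0// mulrC -normfV.
by rewrite -{1}(scalerK a0 f) tc_normZ_le// memvZ.
Qed.

Lemma tc_norm_eq0 f : f \in tc_space -> tc_norm f = 0 -> f = 0.
Proof.
move=> fT f0; pose C := \sum_(x : X) \sum_(y : X) (fdist x y)^-1.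
have C0 : 0 <= C by rewrite !sumr_ge0// => x _; rewrite sumr_ge0// => y _;
  rewrite invr_ge0 fdist_ge0.
have CP (x y : X) : x != y -> 1 <= C * fdist x y.
  move=> xy; have d0 : 0 < fdist x y by rewrite lt0r fdist_eq0 xy fdist_ge0.
  rewrite -ler_pdivrMr// div1r /C (bigD1 x)//= (bigD1 y)//= -addrA lerDl.
  rewrite addr_ge0 ?sumr_ge0// => z _; rewrite ?sumr_ge0// => *;
  by rewrite invr_ge0 fdist_ge0.
apply/ffunP => z; rewrite ffunE; apply/eqP; rewrite -normr_le0.
apply/ler_addgt0Pr => e e0; rewrite add0r.
have C1 : 0 < C + 1 by rewrite ltr_wpDl.
have [s sf] := tc_norm_lt fT (divr_gt0 e0 C1); rewrite f0 add0r.
rewrite ltr_pdivlMr// => /ltW; apply: le_trans.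
apply: (@le_trans _ _ (C * cost s)); last first.
  by rewrite mulrC ler_wpM2l ?(cost_ge0 sf)// lerDl.
case: sf => s0 ->; rewrite sum_ffunE /cost mulr_sumr (le_trans (ler_norm_sum _ _ _))//.
rewrite big_seq [leRHS]big_seq ler_sum// => c /s0 c0.
rewrite !ffunE normrM (ger0_norm c0) mulrCA ler_wpM2l//.
have [->|cc] := eqVneq c.1.2 c.2.
  by rewrite subrr normr0 mulr_ge0// fdist_ge0.
apply: le_trans (CP _ _ cc); rewrite -[X in `|X|]/((_ : R) - _).
by case: eqP => _; case: eqP => _;
  rewrite ?subrr ?subr0 ?sub0r ?normrN ?normr0 ?normr1 ?ler01.
Qed.

End TransportationCost.

Definition TC (R : realType) (X : finMetric R) := subvs_of (@tc_space R X).

HB.instance Definition _ (R : realType) (X : finMetric R) :=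
  Vector.on (@TC R X).

Lemma TC_norm_eq0 (R : realType) (X : finMetric R) (f : @TC R X) :
  tc_norm (vsval f) = 0 -> f = 0.
Proof. by move=> /(tc_norm_eq0 (subvsP f)) f0; exact: val_inj. Qed.

HB.instance Definition _ (R : realType) (X : finMetric R) :=
  Lmodule_isNormed.Build R (@TC R X) (norm := fun f => tc_norm (vsval f))
    (fun f g => tc_normD (subvsP f) (subvsP g))
    (fun a f => tc_normZ a (subvsP f))
    (@TC_norm_eq0 R X).

Lemma TC_normE (R : realType) (X : finMetric R) (f : @TC R X) :
  `|f| = tc_norm (vsval f).
Proof. by []. Qed.

(* An alias, because 'rV[R]_N itself carries the sup norm. *)
Definition ell1 (R : realType) (N : nat) := 'rV[R]_N.

HB.instance Definition _ (R : realType) (N : nat) := Vector.on (@ell1 R N).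

Section Ell1.
Context {R : realType} {N : nat}.

Definition ell1_norm (x : ell1 R N) : R := \sum_(i < N) `|x ord0 i|.

Lemma ell1_normD x y : ell1_norm (x + y) <= ell1_norm x + ell1_norm y.
Proof. by rewrite -big_split ler_sum// => i _; rewrite mxE ler_normD. Qed.

Lemma ell1_normZ a x : ell1_norm (a *: x) = `|a| * ell1_norm x.
Proof. by rewrite mulr_sumr; apply: eq_bigr => i _; rewrite mxE normrM. Qed.

Lemma ell1_norm_eq0 x : ell1_norm x = 0 -> x = 0.
Proof.
move=> /eqP; rewrite psumr_eq0// => /allP x0; apply/rowP => i; rewrite mxE.
by apply/eqP; have := x0 i; rewrite mem_index_enum normr_eq0; apply.
Qed.

HB.instance Definition _ :=
  Lmodule_isNormed.Build R (ell1 R N) ell1_normD ell1_normZ ell1_norm_eq0.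

Lemma ell1_normE (x : ell1 R N) : `|x| = \sum_(i < N) `|x ord0 i|.
Proof. by []. Qed.

End Ell1.

Section BanachMazur.
Context {R : realType}.
Local Open Scope ereal_scope.

Definition opnorm (V W : normedModType R) (T : V -> W) : \bar R :=
  ereal_sup [set `|T x|%:E | x in [set x : V | (`|x| <= 1)%R]].

(* Equal to +oo if the spaces are not linearly isomorphic. *)
Definition bm_dist (V W : normedModType R) : \bar R :=
  ereal_inf [set d | exists (T : {linear V -> W}) (S : {linear W -> V}),
    [/\ cancel T S, cancel S T & d = opnorm T * opnorm S]].

End BanachMazur.

(* Main.v *)
(** Lifting the images of the unit vectors of ell_1^N along the quotient map
    q : ell_1(E) -> TC, 1_e |-> 1_x - 1_y for e = xy, turns a pair T, S = T^-1
    into an operator M = L q on ell_1(E) of norm at most |T| |S| + eps such that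
    q M = q; hence D = 1 - M is a projection onto the cycle space ker q.  It
    remains to bound |1 - D| from below for all such projections at once, which
    is done by trace duality: there are edge weights nu of total mass 1 and
    coefficients s(e, f) in [-1, 1], zero on the diagonal, for which the sum of
    nu(e) s(e, f) D(f, e) is 3n/8 whatever D is.  They are built recursively.
    Passing from L_n to L_{n+1}, the cycle space gains one cycle in every copy
    of L_1, and a kernel on the six edges of L_1 collects 3/8 from it. *)
Require Import Defs.
From mathcomp Require Import all_boot all_order all_algebra.
From mathcomp Require Import all_classical all_reals all_analysis.
From mathcomp Require Import zify ring lra.
Import Order.TTheory GRing.Theory Num.Theory.
(* [total] and [indic] also name other library constants. *)
Import Defs.
Local Open Scope ring_scope.

(** * Cycle space of a graph and projections onto it *)

Section Cycles.
Context {R : realFieldType} {G : graph}.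
Implicit Types c d : edge G -> R.

(** The quotient map q in coordinates, with edges oriented by [ends]; its kernel is the cycle
    space. *)
Definition boundary c (v : vertex G) : R :=
  \sum_e c e * ((v == (ends e).1)%:R - (v == (ends e).2)%:R).

Definition is_cycle c := forall v, boundary c v = 0.

(** Matrix form of a linear projection onto the cycle space: the unit vector at [e] goes to
    [D e]. *)
Definition cycle_projection (D : edge G -> edge G -> R) :=
  (forall e, is_cycle (D e)) /\
  (forall c, is_cycle c -> forall f, \sum_e c e * D e f = c f).

Lemma is_cycle_sum (I : finType) (a : I -> R) (d : I -> edge G -> R) :
  (forall i, is_cycle (d i)) -> is_cycle (fun e => \sum_i a i * d i e).
Proof.
move=> dc v; rewrite /boundary.
under eq_bigr do rewrite mulr_suml.
rewrite exchange_big big1// => i _.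
under eq_bigr do rewrite -mulrA.
by rewrite -mulr_sumr -/(boundary (d i) v) dc mulr0.
Qed.

End Cycles.

Local Notation o6 k := (@Ordinal 6 k isT).

Lemma sum6 (R : nmodType) (F : 'I_6 -> R) :
  \sum_i F i = F (o6 0) + F (o6 1) + F (o6 2) + F (o6 3) + F (o6 4) + F (o6 5).
Proof.
rewrite !big_ord_recl big_ord0 addr0 !addrA.
by congr (_ + _ + _ + _ + _ + _); congr (F _); apply: val_inj.
Qed.

Lemma sum_step (R : nmodType) (G : graph) (F : edge (laakso_step G) -> R) :
  \sum_ei F ei = \sum_e \sum_i F (e, i).
Proof. by rewrite pair_bigA; apply: eq_bigr => -[e i]. Qed.

(** * Cycles after replacing every edge by a copy of L_1 *)

Section Step.
Context {R : realFieldType} {G : graph}.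
Implicit Types (c : edge (laakso_step G) -> R) (e : edge G).

Lemma boundary_outer c v : boundary c (inl v) =
  \sum_e (c (e, o6 0) * (v == (ends e).1)%:R - c (e, o6 5) * (v == (ends e).2)%:R).
Proof.
rewrite /boundary sum_step/=.
apply: eq_bigr => e _; rewrite sum6.
have inlE (x : vertex G) : (inl v == inl x :> vertex G + edge G * 'I_4) = (v == x).
  by apply/eqP/eqP => [[]|->].
by rewrite /tnth/= !inlE; ring.
Qed.

Lemma boundary_inner c e (k : 'I_4) : boundary c (inr (e, k)) =
  nth 0 [:: c (e, o6 1) + c (e, o6 3) - c (e, o6 0);
            c (e, o6 2) - c (e, o6 1);
            c (e, o6 4) - c (e, o6 3);
            c (e, o6 5) - c (e, o6 2) - c (e, o6 4)] k.
Proof.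
rewrite /boundary sum_step/=.
rewrite (bigD1 e)//= [X in _ + X]big1 ?addr0 => [|e' ne].
  rewrite sum6 /tnth/=.
  have inrE j : (inr (e, k) == inr (e, inord j) :> vertex G + edge G * 'I_4) =
    (k == inord j) by apply/eqP/eqP => [[]|->].
  rewrite !inrE -!val_eqE /= !inordK//.
  by case: k {inrE} => [[|[|[|[|]]]]]//= ?; ring.
rewrite sum6 /tnth/=.
have inrE j : (inr (e, k) == inr (e', inord j) :> vertex G + edge G * 'I_4) = false.
  by apply/eqP => -[ee]; move: ne; rewrite ee eqxx.
by rewrite !inrE /=; ring.
Qed.

(** Conservation at u, p, q, v leaves two parameters per copy, the flows through its two branches.
    Their sum enters at b and leaves at t, so at the old vertices the condition is that of a cycle
    of [G]. *)
Lemma cycle_stepP c : is_cycle c <->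
  [/\ forall e, c (e, o6 2) = c (e, o6 1), forall e, c (e, o6 4) = c (e, o6 3),
      forall e, c (e, o6 0) = c (e, o6 1) + c (e, o6 3),
      forall e, c (e, o6 5) = c (e, o6 1) + c (e, o6 3) &
      is_cycle (fun e => c (e, o6 0))].
Proof.
have H := boundary_inner c.
split=> [cc|[c2 c4 c0 c5 cG]].
  have E2 e : c (e, o6 2) = c (e, o6 1).
    by have := H e (@Ordinal 4 1 isT); rewrite cc /= => ?; lra.
  have E4 e : c (e, o6 4) = c (e, o6 3).
    by have := H e (@Ordinal 4 2 isT); rewrite cc /= => ?; lra.
  have E0 e : c (e, o6 0) = c (e, o6 1) + c (e, o6 3).
    by have := H e (@Ordinal 4 0 isT); rewrite cc /= => ?; lra.
  have E5 e : c (e, o6 5) = c (e, o6 1) + c (e, o6 3).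
    by have := H e (@Ordinal 4 3 isT); rewrite cc /= E2 E4 => ?; lra.
  split=> // v; transitivity (boundary c (inl v)) => //; rewrite boundary_outer.
  apply: eq_bigr => e _.
  by rewrite E5 E0 mulrBr.
case=> [v|[e k]].
  rewrite boundary_outer; transitivity (boundary (fun e => c (e, o6 0)) v) => //.
  apply: eq_bigr => e _.
  by rewrite c5 c0 mulrBr.
by rewrite boundary_inner c5 c2 c4 c0; case: k => [[|[|[|[|]]]]]//= ?; ring.
Qed.

End Step.

(** * Recursive construction of the dual certificate *)

Section Certificate.
Context {R : realFieldType}.

(* [D e] is the column of [D] at [e], so that [D e f] is D(f, e). *)
Definition certificate (G : graph) (a : R) :=
  exists (nu : edge G -> R) (s : edge G -> edge G -> R),
  [/\ forall e, 0 <= nu e, \sum_e nu e = 1, forall e f, `|s e f| <= 1,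
      forall e, s e e = 0 &
      forall D, cycle_projection D ->
        \sum_e nu e * \sum_f s e f * D e f = a].

(* The edges are numbered as in [laakso_edges]: bu, up, pv, uq, qv, vt. *)
Definition unit_flow (i : 'I_6) : R := nth 0 [:: 1; 2^-1; 2^-1; 2^-1; 2^-1; 1] i.

(** The circulation around the 4-cycle. A conserved flow x on the copy is x_0 [unit_flow] + (x_1 -
    x_3)/2 [branch_sign]. *)
Definition branch_sign (i : 'I_6) : R := nth 0 [:: 0; 1; 1; -1; -1; 0] i.

(* In the row of an inner edge, 1/4 makes the pairing with [unit_flow] vanish, so
   that only the circulation around the 4-cycle is seen; [nth] makes the rows of
   bu and vt zero. *)
Definition step_kernel (i j : 'I_6) : R :=
  nth 0 (nth [::] [:: [::];
                      [:: 4^-1; 0; 1; -1; -1; 4^-1];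
                      [:: 4^-1; 1; 0; -1; -1; 4^-1];
                      [:: 4^-1; -1; -1; 0; 1; 4^-1];
                      [:: 4^-1; -1; -1; 1; 0; 4^-1]] i) j.

Lemma step_kernel_le1 i j : `|step_kernel i j| <= 1.
Proof.
rewrite ler_norml /step_kernel.
by case: i => [[|[|[|[|[|[|]]]]]]]//= ?; case: j => [[|[|[|[|[|[|]]]]]]]//= ?;
  apply/andP; split; lra.
Qed.

Lemma step_kernelii i : step_kernel i i = 0.
Proof. by case: i => [[|[|[|[|[|[|]]]]]]]. Qed.

(** The old coefficients see only the flow through each copy and reproduce [a] by averaging [D] down
    to [G]; the kernel sees only the circulation within a copy, which every projection must fix. *)
Lemma certificate_step (G : graph) (a : R) :
  certificate G a -> certificate (laakso_step G) (a + 3 / 8).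
Proof.
move=> [nu [s [nu0 nu1 s1 s0 sD]]].
(* The entries of [unit_flow] add up to 4. *)
exists (fun ei => nu ei.1 * (unit_flow ei.2 / 4)).
exists (fun ei fj => s ei.1 fj.1 + (ei.1 == fj.1)%:R * step_kernel ei.2 fj.2).
split=> [[e i]||[e i] [f j]|[e i]|D [Dcyc Dfix]] /=.
- rewrite mulr_ge0// divr_ge0//.
  by case: i => [[|[|[|[|[|[|]]]]]]]//= ?; rewrite /unit_flow /=; lra.
- rewrite sum_step/=.
  rewrite -[RHS]nu1; apply: eq_bigr => e _.
  by rewrite sum6 /unit_flow/=; field.
(* The two summands of the new coefficient never overlap, since [s] vanishes on the diagonal. *)
- have [->|_] := eqVneq e f; last by rewrite mul0r addr0.
  by rewrite s0 add0r mul1r step_kernel_le1.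
- by rewrite s0 eqxx step_kernelii mulr0 addr0.
have DP ei : _ := (cycle_stepP (D ei)).1 (Dcyc ei).
(* A flow x on a copy has entries adding up to 4 x_0. The kernel row kills [unit_flow] and pairs
   with [branch_sign] to 3 times the sign of the row. *)
have row e i : \sum_fj (s e fj.1 + (e == fj.1)%:R * step_kernel i fj.2) * D (e, i) fj =
    4 * (\sum_f s e f * D (e, i) (f, o6 0)) +
    3 / 2 * branch_sign i * (D (e, i) (e, o6 1) - D (e, i) (e, o6 3)).
  have [D2 D4 D0 D5 _] := DP (e, i).
  transitivity (\sum_fj (s e fj.1 * D (e, i) fj +
      (e == fj.1)%:R * (step_kernel i fj.2 * D (e, i) fj))).
    by apply: eq_bigr => fj _; ring.
  rewrite big_split/=; congr (_ + _).
    rewrite sum_step mulr_sumr.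
    by apply: eq_bigr => f _; rewrite sum6/= D2 D4 D0 D5; ring.
  rewrite sum_step/=.
  rewrite (bigD1 e)//= [X in _ + X]big1 ?addr0 => [|f]; last first.
    by rewrite eq_sym => /negbTE ->; rewrite big1// => j _; rewrite mul0r.
  rewrite eqxx sum6 D2 D4 D0 D5 /step_kernel /branch_sign.
  by case: i {DP D2 D4 D0 D5} => [[|[|[|[|[|[|]]]]]]]//= ?; field.
(* Where [branch_sign] is nonzero, [unit_flow] is 1/2, and 1/2 * 1/4 * 3/2 = 3/16. *)
transitivity (\sum_ei nu ei.1 * (unit_flow ei.2 * \sum_f s ei.1 f * D ei (f, o6 0)) +
    \sum_ei nu ei.1 * (3 / 16 * (branch_sign ei.2 *
      (D ei (ei.1, o6 1) - D ei (ei.1, o6 3))))).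
  rewrite -big_split; apply: eq_bigr => -[e i] _ /=; rewrite row.
  by case: i => [[|[|[|[|[|[|]]]]]]]//= ?; rewrite /unit_flow /branch_sign/=; field.
congr (_ + _).
  (* Spread an edge of [G] along [unit_flow], apply [D], and read the flow through each copy at its
     edge bu: this is a cycle projection of [G]. *)
  pose D' e f := \sum_i unit_flow i * D (e, i) (f, o6 0).
  rewrite -(sD D'); last first.
    split=> [e|c cc f]; first by apply: is_cycle_sum => i; have [] := DP (e, i).
    pose uc (ei : edge (laakso_step G)) := c ei.1 * unit_flow ei.2.
    have /Dfix/(_ (f, o6 0)) : is_cycle uc.
      apply/cycle_stepP; rewrite /uc /unit_flow; split=> //= e; try by field.
      transitivity (boundary c e) => //.
      by apply: eq_bigr => f' _; rewrite mulr1.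
    rewrite /uc /= /unit_flow /= mulr1 => <-.
    rewrite sum_step/=.
    apply: eq_bigr => e _; rewrite /D' mulr_sumr.
    by apply: eq_bigr => i _; rewrite mulrA.
  rewrite sum_step/=.
  apply: eq_bigr => e _; rewrite -mulr_sumr; congr (_ * _).
  under eq_bigr do rewrite mulr_sumr.
  rewrite exchange_big; apply: eq_bigr => f _.
  by rewrite /D' mulr_sumr; apply: eq_bigr => i _; rewrite mulrCA.
rewrite sum_step/=.
transitivity (\sum_e nu e * (3 / 8 : R)); last by rewrite -mulr_suml nu1 mul1r.
apply: eq_bigr => e _; rewrite -mulr_sumr; congr (_ * _); rewrite -mulr_sumr.
(* The circulation in the copy of [e] is a cycle, hence fixed by [D]; its values 1 and -1 on the two
   branches differ by 2, and 2 * 3/16 = 3/8. *)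
pose z (ei : edge (laakso_step G)) : R := (ei.1 == e)%:R * branch_sign ei.2.
have zc : is_cycle z.
  apply/cycle_stepP; rewrite /z /branch_sign; split=> //= [e'|e'|v].
  - by rewrite mulr0; ring.
  - by rewrite mulr0; ring.
  - by rewrite /boundary big1// => e' _; rewrite mulr0 mul0r.
have zD f : \sum_i branch_sign i * D (e, i) f = z f.
  rewrite -(Dfix z zc f).
  rewrite sum_step /z/=.
  rewrite (bigD1 e)//= [X in _ + X]big1 ?addr0 => [|e' /negbTE ->].
    by apply: eq_bigr => i _; rewrite eqxx mul1r.
  by rewrite big1// => i _; rewrite !mul0r.
under eq_bigr do rewrite mulrBr.
by rewrite sumrB !zD /z /branch_sign/= eqxx /=; field.
Qed.

Lemma certificate_laakso n : certificate (laakso n) (3 * n%:R / 8).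
Proof.
elim: n => [|n IH].
  exists (fun=> 1), (fun _ _ => 0); split=> // [|e f|D _].
  - by rewrite big_const cardT enumT unlock /= addr0.
  - by rewrite normr0.
  - rewrite mulr0 mul0r big1// => e _; rewrite big1 ?mulr0// => f _; exact: mul0r.
rewrite -natr1 (_ : _ / 8 = 3 * n%:R / 8 + 3 / 8); last by field.
exact: certificate_step.
Qed.

End Certificate.

(** * Dimension of the transportation cost space *)

Lemma dim_TC (R : realType) (X : finMetric R) (x : X) : \dim {:TC X} = #|X|.-1.
Proof.
transitivity (\dim (@tc_space R X)); first exact: dimvf.
have := limg_ker_dim (linfun (@total R X)) fullv.
rewrite capfv -/(tc_space) dimvf /dim/= muln1 => <-.
suff -> : (linfun (@total R X) @: fullv)%VS = fullv by rewrite dimvf addn1.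
apply/eqP; rewrite eqEsubv subvf/=; apply/subvP => a _.
(* Rank-nullity for [total], which is onto because multiples of one indicator attain every value. *)
have -> : a = linfun (@total R X) (a *: indic x).
  rewrite linearZ /= lfunE /= /total (bigD1 x)//= ffunE eqxx big1 => [|v /negbTE vx].
    by rewrite addr0 /GRing.scale /= mulr1.
  by rewrite ffunE vx.
by rewrite memv_img// memvf.
Qed.

Lemma card_laakso_edge n : #|edge (laakso n)| = (6 ^ n)%N.
Proof.
elim: n => [|n IH]; first by rewrite card_unit.
by rewrite [laakso _]/= card_prod card_ord -/(laakso n) IH expnSr.
Qed.

Lemma card_laakso_vertex n :
  (5 * #|vertex (laakso n)| = 4 * 6 ^ n + 6)%N.
Proof.
elim: n => [|n IH]; first by rewrite card_bool.
rewrite [laakso _]/= card_sum card_prod card_ord -/(laakso n) card_laakso_edge.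
by rewrite mulnDr IH expnS; lia.
Qed.

(** * From operator bounds to the Banach-Mazur distance *)

Section OperatorNorm.
Context {R : realType} {V W : normedModType R}.

Lemma normr_le_opnorm (T : {linear V -> W}) a x :
  opnorm T = a%:E -> `|T x| <= a * `|x|.
Proof.
move=> Ta; have [->|x0] := eqVneq x 0; first by rewrite linear0 !normr0 mulr0.
have x1 : 0 < `|x| by rewrite normr_gt0.
rewrite -ler_pdivrMr// -lee_fin -Ta.
apply: ereal_sup_ubound; exists (`|x|^-1 *: x) => /=.
  by rewrite normrZ normfV normr_id mulVf// gt_eqF.
by rewrite linearZ normrZ normfV normr_id mulrC.
Qed.

Lemma opnorm_gt0 (T : V -> W) x : (forall a y, T (a *: y) = a *: T y) ->
  T x != 0 -> (0 < opnorm T)%E.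
Proof.
move=> TZ Tx; have x0 : x != 0.
  by apply: contra_neq Tx => ->; rewrite -(scale0r x) TZ scale0r.
have x1 : 0 < `|x| by rewrite normr_gt0.
apply: (@lt_le_trans _ _ (`|T (`|x|^-1 *: x)|)%:E).
  by rewrite lte_fin normr_gt0 TZ scaler_eq0 invr_eq0 gt_eqF.
apply: ereal_sup_ubound; exists (`|x|^-1 *: x) => //=.
by rewrite normrZ normfV normr_id mulVf// gt_eqF.
Qed.

End OperatorNorm.

(** The nonzero [x] makes both operator norms positive, so an infinite one makes the product
    infinite and only finite bounds remain. *)
Lemma bm_dist_ge (R : realType) (V W : normedModType R) (r : R) (x : V) :
  x != 0 ->
  (forall (T : {linear V -> W}) (S : {linear W -> V}) (a b : R),
    cancel T S -> 0 <= a -> 0 <= b ->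
    (forall x, `|T x| <= a * `|x|) -> (forall y, `|S y| <= b * `|y|) ->
    r <= a * b) ->
  (r%:E <= bm_dist V W)%E.
Proof.
move=> x0 H; apply: le_ereal_inf_tmp => _ [T [S [TK SK ->]]].
have T0 : (0 < opnorm T)%E.
  apply: (@opnorm_gt0 _ _ _ _ x) => [c y|]; first exact: linearZ.
  by apply: contra_neq x0 => Tx; rewrite -(TK x) Tx linear0.
have S0 : (0 < opnorm S)%E.
  apply: (@opnorm_gt0 _ _ _ _ (T x)) => [c y|]; first exact: linearZ.
  by rewrite TK.
case ET : (opnorm T) T0 => [a| |]// a0; last by rewrite gt0_mulye// leey.
case ES : (opnorm S) S0 => [b| |]// b0; last by rewrite gt0_muley// leey.
rewrite -EFinM lee_fin; apply: (H T S) => // [| |y|y].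
- by rewrite ltW.
- by rewrite ltW.
- exact: normr_le_opnorm.
- exact: normr_le_opnorm.
Qed.

(** * Lifting along q and applying the certificate *)

Section EdgeLifts.
Context {R : realType} {G : graph}.
Hypothesis cG : connected_graph G.
Let X := graph_metric cG R.

Lemma path_lift (x : X) (p : seq X) : path (@adj G) x p ->
  exists c : edge G -> R, (forall v, boundary c v = indic x v - indic (last x p) v) /\
    \sum_e `|c e| <= (size p)%:R.
Proof.
elim: p x => [|y p IH] x /=.
  move=> _; exists (fun=> 0); split=> [v|].
    by rewrite subrr /boundary big1// => e _; rewrite mul0r.
  by rewrite big1// => e _; rewrite normr0.
case/andP => /existsP[e0 xy] /IH[c [bc nc]].
(* The sign records whether the path runs along or against the orientation of [e0]. *)
pose a : R := if ends e0 == (x, y) then 1 else -1.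
have a1 : `|a| = 1 by rewrite /a; case: ifP; rewrite ?normrN normr1.
exists (fun e => c e + a * (e == e0)%:R); split=> [v|].
  rewrite /boundary; under eq_bigr do rewrite mulrDl.
  rewrite big_split/= -/(boundary c v) bc.
  rewrite (bigD1 e0)//= big1 => [|e /negbTE ->]; last by rewrite mulr0 mul0r.
  rewrite eqxx mulr1 addr0 !ffunE /a; case: ifP xy => [/eqP -> _|_ /=].
    by rewrite mul1r/=; ring.
  by move=> /eqP ->/=; ring.
apply: (@le_trans _ _ (\sum_e (`|c e| + (e == e0)%:R))).
  apply: ler_sum => e _; rewrite (le_trans (ler_normD _ _))// lerD2l normrM a1 mul1r.
  by rewrite normr_nat.
rewrite big_split/= -natr1 lerD// (bigD1 e0)//= eqxx big1 ?addr0//.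
by move=> e /negbTE ->.
Qed.

(** Route each transport of a nearly optimal plan along a shortest path; the slack [e] is there
    because the norm is an infimum. *)
Lemma tc_lift (f : {ffun X -> R^o}) (e : R) : f \in tc_space -> 0 < e ->
  exists c : edge G -> R, (forall v, boundary c v = f v) /\
    \sum_i `|c i| <= tc_norm f + e.
Proof.
move=> fT e0; have [s [s0 ->] cs] := tc_norm_lt fT e0.
suff [c [bc nc]] : exists c : edge G -> R,
    (forall v, boundary c v =
       (\sum_(t <- s) t.1.1 *: (indic t.1.2 - indic t.2) : {ffun X -> R^o}) v) /\
    \sum_i `|c i| <= cost s.
  by exists c; split=> //; rewrite (le_trans nc)// ltW.
elim: s s0 {fT cs} => [|t s IH] s0.
  exists (fun=> 0); split=> [v|].
    by rewrite big_nil ffunE /boundary big1// => i _; rewrite mul0r.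
  by rewrite /cost big_nil big1// => i _; rewrite normr0.
have [|c [bc nc]] := IH; first by move=> u us; rewrite s0// inE us orbT.
have t0 : 0 <= t.1.1 by rewrite s0// mem_head.
have [p [xp lp sp]] := gdist_path cG t.1.2 t.2.
have [d [bd nd]] := path_lift _ _ xp.
exists (fun i => t.1.1 * d i + c i); split=> [v|].
  rewrite /boundary; under eq_bigr do rewrite mulrDl -mulrA.
  rewrite big_split/= -mulr_sumr -/(boundary c v) -/(boundary d v) bc bd lp.
  by rewrite big_cons !ffunE.
rewrite /cost big_cons -/(cost s) (@le_trans _ _ (\sum_i (t.1.1 * `|d i| + `|c i|)))//.
  by apply: ler_sum => i _; rewrite (le_trans (ler_normD _ _))// normrM (ger0_norm t0).
by rewrite big_split/= -mulr_sumr lerD// ler_wpM2l// -sp.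
Qed.

Definition edge_vector (e : edge G) : {ffun X -> R^o} :=
  indic ((ends e).1 : X) - indic ((ends e).2 : X).

Lemma edge_vector_tc e : edge_vector e \in tc_space.
Proof.
apply/tc_spaceP; under eq_bigr do rewrite !ffunE.
rewrite sumrB; apply/eqP; rewrite subr_eq0; apply/eqP.
have H (x : X) : \sum_(v : X) ((v == x)%:R : R) = 1.
  by rewrite (bigD1 x)//= eqxx big1 ?addr0// => v /negbTE ->.
by rewrite !H.
Qed.

Lemma tc_norm_edge_vector e : tc_norm (edge_vector e) <= 1.
Proof.
apply: (le_trans (@tc_norm_le _ _ [:: (1, (ends e).1 : X, (ends e).2 : X)] _ _)).
  split=> [c|]; first by rewrite inE => /eqP -> /=.
  by rewrite big_seq1 scale1r.
rewrite /cost big_seq1 mul1r /= -[1]/(1%:R) ler_nat.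
apply: (@gdist_le _ _ [:: (ends e).2]); rewrite /= andbT.
by apply/existsP; exists e; rewrite -surjective_pairing eqxx.
Qed.

Definition edge_tc (e : edge G) : TC X := vsproj tc_space (edge_vector e).

Lemma vsval_edge_tc e : vsval (edge_tc e) = edge_vector e.
Proof. by rewrite vsprojK// edge_vector_tc. Qed.

Lemma boundary_edge_tc (c : edge G -> R) v :
  boundary c v = vsval (\sum_e c e *: edge_tc e) v.
Proof.
rewrite linear_sum sum_ffunE; apply: eq_bigr => e _.
by rewrite linearZ/= vsval_edge_tc !ffunE.
Qed.

Lemma certificate_bound (a : R) (N : nat) (T : {linear TC X -> ell1 R N})
    (S : {linear ell1 R N -> TC X}) (t s : R) :
  certificate G a -> cancel T S -> 0 <= t -> 0 <= s ->
  (forall x, `|T x| <= t * `|x|) -> (forall y, `|S y| <= s * `|y|) ->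
  a <= t * s.
Proof.
move=> [nu [k [nu0 nu1 k1 kk kD]]] TK t0 s0 tT sS.
suff H (e : R) : 0 < e -> a <= t * (s + e).
  (* Dividing by [t + 1] rather than [t] covers the case [t = 0]. *)
  apply/ler_addgt0Pr => e e0; have t1 : 0 < t + 1 by rewrite ltr_wpDl.
  have := H _ (divr_gt0 e0 t1); rewrite mulrDr => /le_trans; apply.
  rewrite lerD2l mulrCA ler_piMr ?ltW// ltr_pdivrMr// mul1r.
  by rewrite ltrDl.
move=> e0; pose dl i : ell1 R N := delta_mx 0 i.
have Sdl i : `|S (dl i)| <= s.
  rewrite (le_trans (sS _))// ell1_normE (bigD1 i)//= mxE !eqxx normr1.
  rewrite big1 ?addr0 ?mulr1// => j ji.
  by rewrite mxE eqxx/= (negbTE ji) normr0.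
(* An operator from ell_1 is bounded by its values on the unit vectors, so these can be lifted
   independently of each other. *)
have /choice[l lP] i : exists c : edge G -> R,
    (forall v, boundary c v = vsval (S (dl i)) v) /\ \sum_f `|c f| <= s + e.
  have [c [bc nc]] := tc_lift _ _ (subvsP (S (dl i))) e0.
  by exists c; split=> //; rewrite (le_trans nc)// lerD2r Sdl.
pose M (g f : edge G) : R := \sum_i T (edge_tc g) ord0 i * l i f.
have Mn g : \sum_f `|M g f| <= t * (s + e).
  apply: (@le_trans _ _ (\sum_f \sum_i `|T (edge_tc g) ord0 i| * `|l i f|)).
    apply: ler_sum => f _; rewrite (le_trans (ler_norm_sum _ _ _))//.
    by apply: ler_sum => i _; rewrite normrM.
  rewrite exchange_big/=.
  apply: (@le_trans _ _ (\sum_i `|T (edge_tc g) ord0 i| * (s + e))).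
    by apply: ler_sum => i _; rewrite -mulr_sumr ler_wpM2l//; case: (lP i).
  rewrite -mulr_suml -ell1_normE ler_wpM2r ?addr_ge0 ?(ltW e0)//.
  rewrite (le_trans (tT _))// ler_piMr//.
  by rewrite TC_normE vsval_edge_tc tc_norm_edge_vector.
pose D (g f : edge G) : R := (f == g)%:R - M g f.
have Dproj : cycle_projection D.
  split=> [g v|c cc f].
    (* This is q M = q, which follows from S T = 1. *)
    have bM : boundary (M g) v = edge_vector g v.
      rewrite -vsval_edge_tc -[in RHS](TK (edge_tc g)).
      rewrite [in RHS](row_sum_delta (T (edge_tc g))) linear_sum linear_sum sum_ffunE.
      rewrite /boundary /M; under eq_bigr do rewrite mulr_suml.
      rewrite exchange_big; apply: eq_bigr => i _.
      under eq_bigr do rewrite -mulrA.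
      rewrite -mulr_sumr -/(boundary (l i) v) (lP i).1.
      by rewrite linearZ linearZ !ffunE.
    rewrite /boundary; under eq_bigr do rewrite mulrBl.
    rewrite sumrB -/(boundary (M g) v) bM (bigD1 g)//= eqxx mul1r big1.
      by rewrite addr0 !ffunE subrr.
    by move=> f /negbTE ->; rewrite mul0r.
  (* A cycle is killed by q, hence by M, so D = 1 - M fixes it. *)
  have c0 : \sum_g c g *: edge_tc g = 0.
    by apply/val_inj/ffunP => v; rewrite -boundary_edge_tc cc linear0 ffunE.
  under eq_bigr do rewrite mulrBr.
  rewrite sumrB (bigD1 f)//= eqxx mulr1 big1 ?addr0.
    apply/eqP; rewrite subr_eq addrC -subr_eq subrr; apply/eqP.
    rewrite /M; under eq_bigr do rewrite mulr_sumr.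
    rewrite exchange_big/= big1// => i _.
    under eq_bigr do rewrite mulrA.
    rewrite -mulr_suml.
    have := congr1 (fun x : TC X => T x ord0 i) c0.
    rewrite linear_sum linear0 mxE summxE.
    by under eq_bigr do rewrite linearZ mxE; move=> ->; rewrite mul0r.
  by move=> g gf; rewrite eq_sym (negbTE gf) mulr0.
(* As [k] vanishes on the diagonal, the identity in D = 1 - M drops out, and each pairing is at most
   the ell_1 norm of a column of M. *)
rewrite -(kD D Dproj).
apply: (@le_trans _ _ (\sum_g nu g * (t * (s + e)))); last by rewrite -mulr_suml nu1 mul1r.
apply: ler_sum => g _; rewrite ler_wpM2l// (le_trans _ (Mn g))//.
apply: ler_sum => f _; rewrite /D; have [->|_] := eqVneq f g.
  by rewrite kk mul0r.
rewrite sub0r (le_trans (ler_norm _))// normrM normrN.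
by rewrite ler_piMl.
Qed.

End EdgeLifts.

Theorem corollary17 (R : realType) (n : nat) (hn : (1 <= n)%N) :
  let N := ((4 * 6 ^ n + 1) %/ 5)%N in
  \dim {:TC (laakso_metric R n)} = N /\
  (((3 * n%:R - 5) / 8)%:E
     <= bm_dist (TC (laakso_metric R n)) (ell1 R N))%E.
Proof.
move=> N; have cardE := card_laakso_vertex n.
have /card_gt0P[x _] : (0 < #|vertex (laakso n)|)%N by lia.
have dimE : \dim {:TC (laakso_metric R n)} = N.
  rewrite (@dim_TC R (laakso_metric R n) x) /N.
  by rewrite (_ : 4 * 6 ^ n + 1 = #|vertex (laakso n)|.-1 * 5)%N ?mulnK//; lia.
split=> //.
have z0 : vpick {:TC (laakso_metric R n)} != 0.
  rewrite vpick0 -dimv_eq0 dimE -lt0n divn_gt0//.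
  by have := expn_gt0 6 n; lia.
apply: (bm_dist_ge _ _ _ _ _ z0) => T S a b TK a0 b0 Ta Sb.
(* The certificate yields 3n/8, more than the claimed bound. *)
apply: le_trans (certificate_bound _ _ _ T S _ _ (certificate_laakso n) TK a0 b0 Ta Sb).
by lra.
Qed.
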